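(* Let $G$ be an $n\times n$ grid with $n$ even. Every initial configuration of $k\ge3$ robots on distinct nodes of $G$ in which exactly two corners of the minimum enclosing square are occupied, which is non-partitive and is not a 2S2 configuration, is gatherable despite at most one crash fault.
   Context: Model. The grid is the anonymous grid graph. A configuration is $f:V(G)\to\{0,1,2\}$ ($0$ empty, $1$ singleton, $2$ multiplicity). Robots are anonymous, identical, oblivious, cannot communicate, share no coordinate system, orientation or chirality, run the same deterministic algorithm in Look–Compute–Move cycles (snapshot of the whole configuration with weak multiplicity detection; decision; instantaneous move to an adjacent node or stay), fully asynchronously (finite but unbounded adversarial delays; every non-crashed robot activated infinitely often). At most one robot may crash at an adversarial time (stops forever, stays visible, indistinguishable). Gatherable despite at most one crash fault: some such algorithm guarantees in every execution with at most one crash that after finite time all non-crashed robots are on one node and remain there. Partitive: some automorphism $\varphi$ of $(G,f)$ of order $p>1$ has all orbits of $V(G)$ under $\langle\varphi\rangle$ of size exactly $p$. Minimum enclosing square (MES): smallest square subgrid with the same geometric center as the grid containing all occupied nodes; its corners are its four corner nodes. 2S2: exactly two MES corners are occupied, they are diagonally opposite, and the configuration is invariant under reflection in the MES diagonal through the two unoccupied corners. *)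

(* Defs.v *)
(* Model of asynchronous LCM oblivious robots on an
   anonymous n x n grid, with weak multiplicity detection and at most one crash. *)
From mathcomp Require Import all_boot.

Set Implicit Arguments.
Unset Strict Implicit.
Unset Printing Implicit Defensive.

Definition node (n : nat) : finType := ('I_n * 'I_n)%type.

Definition adjn (a b : nat) : bool := (a.+1 == b) || (b.+1 == a).

Definition adj {n : nat} (u v : node n) : bool :=
  ((u.1 == v.1) && adjn u.2 v.2) || ((u.2 == v.2) && adjn u.1 v.1).

Definition graph_aut {n : nat} (s : node n -> node n) : Prop :=
  injective s /\ forall u v, adj (s u) (s v) = adj u v.

(* f : V(G) -> {0,1,2}, 0 empty, 1 singleton, 2 multiplicity *)
Definition config {n k : nat} (pos : 'I_k -> node n) : node n -> nat :=
  fun v => minn 2 #|[set i | pos i == v]|.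

Definition partitive {n : nat} (f : node n -> nat) : Prop :=
  exists (phi : node n -> node n) (p : nat),
    [/\ graph_aut phi, (forall v, f (phi v) = f v), 1 < p,
        (forall v, iter p phi v = v) &
        (forall v m, 0 < m < p -> iter m phi v <> v)].

(* centered square subgrid with offset a: coordinates in [a, n-1-a] *)
Definition encloses {n : nat} (f : node n -> nat) (a : nat) : Prop :=
  forall v : node n, f v != 0 ->
    (a <= v.1 <= n.-1 - a) && (a <= v.2 <= n.-1 - a).

Definition is_mes {n : nat} (f : node n -> nat) (a : nat) : Prop :=
  [/\ a < n./2, encloses f a &
      forall b, b < n./2 -> encloses f b -> b <= a].

Definition mes_corner {n : nat} (a : nat) (v : node n) : bool :=
  ((v.1 == a :> nat) || (v.1 == n.-1 - a :> nat)) &&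
  ((v.2 == a :> nat) || (v.2 == n.-1 - a :> nat)).

Definition occ_corners {n : nat} (f : node n -> nat) (a : nat) : {set node n} :=
  [set v | mes_corner a v && (f v != 0)].

Definition two_mes_corners {n : nat} (f : node n -> nat) : Prop :=
  exists a, is_mes f a /\ #|occ_corners f a| = 2.

(* the two reflections of the grid in its diagonals (which are the MES diagonals) *)
Definition refl_main {n : nat} (v : node n) : node n := (v.2, v.1).
Definition refl_anti {n : nat} (v : node n) : node n := (rev_ord v.2, rev_ord v.1).

Definition is_2S2 {n : nat} (f : node n -> nat) : Prop :=
  exists a, [/\ is_mes f a, #|occ_corners f a| = 2,
    (exists u w, [/\ u \in occ_corners f a, w \in occ_corners f a,
                     u.1 != w.1 & u.2 != w.2]) &
    (* invariance under the reflection in the MES diagonal through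
       the two unoccupied corners (the reflection fixing them) *)
    exists rho, [/\ rho = refl_main \/ rho = refl_anti,
       (forall v, mes_corner a v -> f v = 0 -> rho v = v) &
       (forall v, f (rho v) = f v)]].

Record state (n k : nat) := State {
  pos : 'I_k -> node n;
  pend : 'I_k -> option (node n) }.     (* destination computed, move pending *)

(* Look i tau u : robot i takes a snapshot in the local frame tau
   (tau : local -> global grid automorphism chosen by the adversary;
   u is the robot's own node in local coordinates) and computes;
   Move i : robot i performs its pending (instantaneous) move. *)
Inductive event (n k : nat) :=
| Look of 'I_k & (node n -> node n) & node n
| Move of 'I_k.

(* an algorithm maps a local snapshot and own local node to a local target *)
Definition algorithm (n : nat) := (node n -> nat) -> node n -> node n.

Definition valid_alg {n : nat} (alg : algorithm n) : Prop :=
  forall g u, alg g u = u \/ adj u (alg g u).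

Definition crashed_at {k : nat} (crash : option ('I_k * nat)) (t : nat) (i : 'I_k)
  : bool :=
  if crash is Some (c, tc) then (c == i) && (tc <= t) else false.

Definition crash_victim {k : nat} (crash : option ('I_k * nat)) (i : 'I_k) : bool :=
  if crash is Some (c, _) then c == i else false.

Definition step {n k : nat} (alg : algorithm n) (cr : 'I_k -> bool)
    (s : state n k) (e : event n k) (s' : state n k) : Prop :=
  match e with
  | Look i tau u =>
      [/\ ~~ cr i, pend s i = None, graph_aut tau, tau u = pos s i &
          (forall j, pos s' j = pos s j)] /\
          (forall j, pend s' j =
             if j == i then Some (tau (alg (fun w => config (pos s) (tau w)) u))
             else pend s j)
  | Move i =>
      ~~ cr i /\ exists d, [/\ pend s i = Some d,
          (forall j, pos s' j = if j == i then d else pos s j) &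
          (forall j, pend s' j = if j == i then None else pend s j)]
  end.

Definition is_look_of {n k : nat} (i : 'I_k) (e : event n k) : bool :=
  if e is Look j _ _ then j == i else false.

Definition execution {n k : nat} (alg : algorithm n) (pos0 : 'I_k -> node n)
    (crash : option ('I_k * nat)) (s : nat -> state n k) (e : nat -> event n k)
  : Prop :=
  [/\ (forall i, pos (s 0) i = pos0 i /\ pend (s 0) i = None),
      (forall t, step alg (crashed_at crash t) (s t) (e t) (s t.+1)) &
      (forall i, ~~ crash_victim crash i ->
         forall t, exists2 t', t <= t' & is_look_of i (e t'))].

Definition gatherable_1crash {n k : nat} (pos0 : 'I_k -> node n) : Prop :=
  exists alg : algorithm n, valid_alg alg /\
    forall crash s e, execution alg pos0 crash s e ->
      exists T (v : node n), forall t, T <= t ->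
        forall i, ~~ crashed_at crash t i -> pos (s t) i = v.

(* Main.v *)
(** The two occupied corners of the minimum enclosing square are not exchanged
    by a symmetry of the initial configuration: such a symmetry would either
    act freely on the nodes (partitive) or be the reflection excluded by 2S2.
    So one of them, A, can be singled out, and it is the gathering point.  The
    robot on A never moves, and every move decreases the L1-distance to A and
    avoids the other three corners.

    While A and the other corner B carry one robot each, only the robot on B
    and the inner robots closest to A (at most two, mirror images of each
    other) move; at least two robots are thus entitled to move, and one crash
    cannot block both.  A stays recognisable because the difference of a
    weight sum seen from B and the one seen from A, nonnegative at the start
    for the right choice of A, strictly increases with every move of an inner
    robot.  Once B is left or A has become a multiplicity, A is the unique
    corner with maximal value, and everybody walks to A.  The sum of the
    distances to A is eventually constant, which forces all robots but the
    crashed one to be on A. *)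
Require Import Defs.
From mathcomp Require Import all_boot zify.
From Stdlib Require Import Classical FunctionalExtensionality.

Set Implicit Arguments.
Unset Strict Implicit.
Unset Printing Implicit Defensive.

(* [simpl] also normalises the implicit arguments of the projections, which
   [lia] compares syntactically. *)
Ltac nlia := simpl in *; lia.

(** * Symmetries of the grid *)

(** Codes for the eight symmetries of the square. The exchange of coordinates precedes the
    reversals, so inverting a frame that has it exchanges the two reversal bits. *)
Definition frame := (bool * bool * bool)%type.

Definition fr {n : nat} (c : frame) (v : node n) : node n :=
  let: (sw, r1, r2) := c in
  let w := if sw then (v.2, v.1) else v in
  (if r1 then rev_ord w.1 else w.1, if r2 then rev_ord w.2 else w.2).

Definition fr_inv (c : frame) : frame :=
  let: (sw, r1, r2) := c in if sw then (true, r2, r1) else c.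

Lemma node_eqP n (u v : node n) :
  (nat_of_ord u.1 = v.1) -> (nat_of_ord u.2 = v.2) -> u = v.
Proof.
by case: u v => [u1 u2] [v1 v2] /= h1 h2; congr pair; apply: val_inj.
Qed.

Lemma frK n c : cancel (@fr n c) (fr (fr_inv c)).
Proof.
by case: c => [[[] []] []] [x y]; rewrite /fr /= ?rev_ordK.
Qed.

Lemma fr_invK n c : cancel (@fr n (fr_inv c)) (fr c).
Proof.
by case: c => [[[] []] []] [x y]; rewrite /fr /= ?rev_ordK.
Qed.

Lemma fr_inj n c : injective (@fr n c).
Proof. exact: can_inj (@frK n c). Qed.

Lemma adjE n (u v : node n) : adj u v =
  ((u.1 == v.1 :> nat) && adjn u.2 v.2) || ((u.2 == v.2 :> nat) && adjn u.1 v.1).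
Proof. by []. Qed.

Lemma adj_fr n c (u v : node n) : adj (fr c u) (fr c v) = adj u v.
Proof.
case: u v => [[u1 h1] [u2 h2]] [[v1 h3] [v2 h4]].
rewrite !adjE /adjn; case: c => [[[] []] []] /=; lia.
Qed.

Lemma graph_aut_fr n c : graph_aut (@fr n c).
Proof. by split; [exact: fr_inj | exact: adj_fr]. Qed.

Lemma graph_aut_comp n (s t : node n -> node n) :
  graph_aut s -> graph_aut t -> graph_aut (fun v => s (t v)).
Proof.
move=> [si sa] [ti ta]; split; first by move=> u v /si /ti.
by move=> u v; rewrite sa ta.
Qed.

Lemma graph_aut_fix n (s : node n -> node n) (i0 i1 : 'I_n) :
  i0 = 0 :> nat -> i1 = 1 :> nat -> graph_aut s ->
  s (i0, i0) = (i0, i0) -> s (i1, i0) = (i1, i0) -> s =1 id.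
Proof.
move=> e0 e1 [si sa] s00 s10.
(* The corner has only two neighbours, and injectivity keeps the image of the second off the
   first. *)
have s01 : s (i0, i1) = (i0, i1).
  have h : adj (s (i0, i1)) (s (i0, i0)).
    by rewrite sa adjE /adjn /= e0 e1.
  have h' : s (i0, i1) <> (i1, i0).
    by rewrite -s10 => /si [] E; move: (congr1 val E) => /=; rewrite e0 e1.
  have nh : ~ ((s (i0, i1)).1 = i1 :> nat /\ (s (i0, i1)).2 = i0 :> nat).
    by move=> [E1 E2]; apply: h'; apply: node_eqP.
  move: h nh; rewrite s00 adjE /adjn /= => h nh.
  by apply: node_eqP ; nlia.
(* Induction on the antidiagonals x + y = d: an interior node is the second
   common neighbour of two fixed nodes, and the two ends of the next
   antidiagonal are then the only remaining neighbours of fixed nodes. *)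
have H d : forall v : node n, v.1 + v.2 <= d.+1 -> s v = v.
  elim: d => [|d IH] v hv.
    have : (v = (i0, i0)) \/ (v = (i1, i0)) \/ (v = (i0, i1)).
      have [h|[h|h]] : (v.1 + v.2 = 0) \/ (v.1 = 1 :> nat /\ v.2 = 0 :> nat) \/
                       (v.1 = 0 :> nat /\ v.2 = 1 :> nat) by lia.
      - by left; apply: node_eqP ; nlia.
      - by right; left; apply: node_eqP ; nlia.
      - by right; right; apply: node_eqP ; nlia.
    by case=> [->|[->|->]].
  have inner (w : node n) : w.1 + w.2 <= d.+2 -> 0 < w.1 -> 0 < w.2 -> s w = w.
    move=> hw w1 w2.
    have l1 : w.1.-1 < n by have := ltn_ord w.1; lia.
    have l2 : w.2.-1 < n by have := ltn_ord w.2; lia.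
    pose p := (Ordinal l1, w.2) : node n; pose q := (w.1, Ordinal l2) : node n.
    pose c := (Ordinal l1, Ordinal l2) : node n.
    have sp : s p = p by apply: IH ; nlia.
    have sq : s q = q by apply: IH ; nlia.
    have sc : s c = c by apply: IH ; nlia.
    have ap : adj (s w) (s p) by rewrite sa adjE /adjn; nlia.
    have aq : adj (s w) (s q) by rewrite sa adjE /adjn; nlia.
    have ac : s w <> c.
      by rewrite -sc => /si E; move: (congr1 (fun v : node n => val v.1) E) ; nlia.
    move: ap aq; rewrite sp sq !adjE /adjn /= => ap aq.
    have nc : ~ ((s w).1 = w.1.-1 :> nat /\ (s w).2 = w.2.-1 :> nat).
      by move=> [E1 E2]; apply: ac; apply: node_eqP.
    by apply: node_eqP; nlia.
  case: (posnP v.1) => v1; case: (posnP v.2) => v2; last exact: inner.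
  - by apply: IH; lia.
  - case: (leqP (v.1 + v.2) d.+1) => hd; first exact: IH.
    have l1 : v.2.-1 < n by have := ltn_ord v.2; lia.
    have l2 : v.2.-2 < n by have := ltn_ord v.2; lia.
    pose p := (v.1, Ordinal l1) : node n; pose q := (v.1, Ordinal l2) : node n.
    pose c := (i1, Ordinal l1) : node n.
    have sp : s p = p by apply: IH ; nlia.
    have sq : s q = q by apply: IH ; nlia.
    have sc : s c = c by apply: inner ; nlia.
    have ap : adj (s v) (s p) by rewrite sa adjE /adjn; nlia.
    have aq : s v <> q.
      by rewrite -sq => /si E; move: (congr1 (fun v : node n => val v.2) E) ; nlia.
    have ac : s v <> c.
      by rewrite -sc => /si E; move: (congr1 (fun v : node n => val v.1) E) ; nlia.
    have nq : ~ ((s v).1 = v.1 :> nat /\ (s v).2 = v.2.-2 :> nat).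
      by move=> [E1 E2]; apply: aq; apply: node_eqP.
    have nc : ~ ((s v).1 = i1 :> nat /\ (s v).2 = v.2.-1 :> nat).
      by move=> [E1 E2]; apply: ac; apply: node_eqP.
    move: ap; rewrite sp !adjE /adjn /= => ap.
    by apply: node_eqP; nlia.
  - case: (leqP (v.1 + v.2) d.+1) => hd; first exact: IH.
    have l1 : v.1.-1 < n by have := ltn_ord v.1; lia.
    have l2 : v.1.-2 < n by have := ltn_ord v.1; lia.
    pose p := (Ordinal l1, v.2) : node n; pose q := (Ordinal l2, v.2) : node n.
    pose c := (Ordinal l1, i1) : node n.
    have sp : s p = p by apply: IH ; nlia.
    have sq : s q = q by apply: IH ; nlia.
    have sc : s c = c by apply: inner ; nlia.
    have ap : adj (s v) (s p) by rewrite sa adjE /adjn; nlia.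
    have aq : s v <> q.
      by rewrite -sq => /si E; move: (congr1 (fun v : node n => val v.1) E) ; nlia.
    have ac : s v <> c.
      by rewrite -sc => /si E; move: (congr1 (fun v : node n => val v.2) E) ; nlia.
    have nq : ~ ((s v).2 = v.2 :> nat /\ (s v).1 = v.1.-2 :> nat).
      by move=> [E1 E2]; apply: aq; apply: node_eqP.
    have nc : ~ ((s v).2 = i1 :> nat /\ (s v).1 = v.1.-1 :> nat).
      by move=> [E1 E2]; apply: ac; apply: node_eqP.
    move: ap; rewrite sp !adjE /adjn /= => ap.
    by apply: node_eqP; nlia.
by move=> v; apply: (H (v.1 + v.2)); lia.
Qed.

(** Corners have degree two; a third neighbour everywhere else forces automorphisms to send corners
    to corners. *)
Lemma noncorner_neighbours n (v : node n) : 3 < n ->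
  ~~ (((v.1 == 0 :> nat) || (v.1 == n.-1 :> nat)) &&
      ((v.2 == 0 :> nat) || (v.2 == n.-1 :> nat))) ->
  exists p q r : node n,
    [/\ [&& adj p v, adj q v & adj r v], p <> q, q <> r & p <> r].
Proof.
case: v => [[x hx] [y hy]] /= n3.
pose nd i j (hi : i < n) (hj : j < n) : node n := (Ordinal hi, Ordinal hj).
have nd_neq i j i' j' hi hj hi' hj' :
    (i != i') || (j != j') -> @nd i j hi hj <> @nd i' j' hi' hj'.
  by move=> h [] /eqP e1 /eqP e2; rewrite e1 e2 in h.
have xm : x.-1 < n by lia.
have ym : y.-1 < n by lia.
have [h|h] := boolP ((y == 0) || (y == n.-1)) => /= hc.
  have xp : x.+1 < n by lia.
  have yz : (if y == 0 then 1 else y.-1) < n by case: eqP; lia.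
  exists (nd _ _ xm hy), (nd _ _ xp hy), (nd _ _ hx yz).
  split; [|apply: nd_neq; lia..].
  by rewrite !adjE /adjn /=; move: h; case: (y =P 0); lia.
have yp : y.+1 < n by lia.
have xz : (if x == 0 then 1 else x.-1) < n by case: eqP; lia.
exists (nd _ _ hx ym), (nd _ _ hx yp), (nd _ _ xz hy).
split; [|apply: nd_neq; lia..].
by rewrite !adjE /adjn /=; case: (x =P 0); lia.
Qed.

(** The image of a corner determines the two reversals, the image of one of its neighbours
    determines the exchange. Undoing this frame leaves an automorphism to which the rigidity of
    [graph_aut_fix] applies. *)
Lemma graph_autP n (s : node n -> node n) :
  3 < n -> graph_aut s -> exists c, s = fr c.
Proof.
move=> n3 sg; have [si sa] := sg.
have l0 : 0 < n by lia.
have l1 : 1 < n by lia.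
pose i0 := Ordinal l0; pose i1 := Ordinal l1.
have sK : bijective s by exact: injF_bij.
have [s' ss' s's] := sK.
have cor : ((s (i0, i0)).1 == 0 :> nat) || ((s (i0, i0)).1 == n.-1 :> nat) /\
           ((s (i0, i0)).2 == 0 :> nat) || ((s (i0, i0)).2 == n.-1 :> nat).
  apply/andP; apply: contraT => /(noncorner_neighbours n3) [p [q [r []]]].
  (* Pulled back along [s], the three nodes would be distinct neighbours of the corner. *)
  rewrite -(s's p) -(s's q) -(s's r) !sa => h pq qr pr.
  move: h pq qr pr; set p' := s' p; set q' := s' q; set r' := s' r.
  rewrite !adjE /adjn /= => h pq qr pr.
  have E (u v : node n) : s u <> s v -> ~ (u.1 = v.1 :> nat /\ u.2 = v.2 :> nat).
    by move=> h' [e1 e2]; apply: h'; congr s; apply: node_eqP.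
  have {}pq := E _ _ pq; have {}qr := E _ _ qr; have {}pr := E _ _ pr.
  by clear -h pq qr pr; nlia.
have [r1 [r2 e00]] : exists r1 r2, s (i0, i0) = fr (false, r1, r2) (i0, i0).
  exists ((s (i0, i0)).1 != 0 :> nat), ((s (i0, i0)).2 != 0 :> nat).
  move: cor; case: (s _) => [[x hx] [y hy]] /= [c1 c2]; apply: node_eqP => /=.
    by case: (x =P 0) c1 => /=; lia.
  by case: (y =P 0) c2 => /=; lia.
have a10 : adj (s (i1, i0)) (s (i0, i0)) by rewrite sa.
have [sw e0] : exists sw, let c := if sw then (true, r1, r2) else (false, r1, r2) in
    s (i0, i0) = fr c (i0, i0) /\ s (i1, i0) = fr c (i1, i0).
  move: a10; rewrite e00 adjE /adjn; case: (s (i1, i0)) => [[x hx] [y hy]] h.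
  (* Coordinates are exchanged exactly when the image of the edge keeps its first coordinate. *)
  exists (x == (fr (false, r1, r2) (i0, i0)).1 :> nat); split; first by case: ifP.
  apply: node_eqP; move: h; case: ifP; case: (r1); case: (r2) => /=; lia.
move: e0; set c := (if sw then _ else _) => -[e0 e1].
exists c; apply: functional_extensionality => v.
have sg' : graph_aut (fun v => fr (fr_inv c) (s v)).
  by apply: graph_aut_comp sg; exact: graph_aut_fr.
have := graph_aut_fix (i0 := i0) (i1 := i1) erefl erefl sg'.
rewrite e0 e1 !frK => /(_ erefl erefl v) E.
by rewrite -[LHS](fr_invK c) E.
Qed.

(** * Transport of configurations and executions along a symmetry *)

Lemma config_comp n k (s : node n -> node n) (p : 'I_k -> node n) v :
  injective s -> config (fun i => s (p i)) (s v) = config p v.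
Proof.
move=> si; rewrite /config; congr minn; apply: eq_card => i.
by rewrite !inE (inj_eq si).
Qed.

(** Snapshots are taken in adversarial frames, so pushing an execution forward by [s] and composing
    every frame with [s] gives an execution of the same algorithm. *)
Lemma gatherable_transport n k (s : node n -> node n) (p : 'I_k -> node n) :
  graph_aut s -> gatherable_1crash (fun i => s (p i)) -> gatherable_1crash p.
Proof.
move=> sg [alg [va H]]; exists alg; split=> // crash st ev [E0 E1 E2].
have [si sa] := sg.
have [s' ss' s's] := injF_bij si.
pose st' t := State (fun i => s (pos (st t) i)) (fun i => omap s (pend (st t) i)).
pose ev' t := match ev t with
  | Look i tau u => Look i (fun v => s (tau v)) u
  | Move i => Move n i
  end.
have ex : execution alg (fun i => s (p i)) crash st' ev'.
  split.
  - by move=> i; have [e0 e] := E0 i; rewrite /st' /= e e0.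
  - move=> t; have := E1 t; rewrite /step /ev' /st'; case: (ev t) => [i tau u|i] /=.
      move=> [[h1 h2 h3 h4 h5] h6]; split; first split => //.
      + by rewrite h2.
      + exact: graph_aut_comp.
      + by rewrite h4.
      + by move=> j; rewrite h5.
      move=> j; rewrite h6; case: eqP => // _ /=; congr (Some (s (tau (alg _ _)))).
      by apply: functional_extensionality => w; rewrite config_comp.
    move=> [h1 [d [h2 h3 h4]]]; split=> //; exists (s d); split.
    + by rewrite h2.
    + by move=> j; rewrite h3; case: eqP.
    + by move=> j; rewrite h4; case: eqP.
  - move=> i hi t; have [t' le h] := E2 i hi t; exists t' => //.
    by move: h; rewrite /ev'; case: (ev t').
have [T [v Hv]] := H _ _ _ ex.
exists T, (s' v) => t le i hi.
by have /= <- := Hv t le i hi; rewrite ss'.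
Qed.

(** * The algorithm *)

Section Algorithm.

(* In the canonical frame A is (a, a); B is (n-1-a, a) if [side] holds and
   (n-1-a, n-1-a) otherwise. [f0] is the initial configuration and [K0] the
   least [key] of its inner robots. *)
Variables (n : nat) (oa : 'I_n) (side : bool) (K0 : nat) (f0 : node n -> nat).

Local Notation cA := ((oa, oa) : node n).
Local Notation cX := ((rev_ord oa, oa) : node n).
Local Notation cY := ((oa, rev_ord oa) : node n).
Local Notation cD := ((rev_ord oa, rev_ord oa) : node n).

Lemma mes_corners : [/\ mes_corner oa cA, mes_corner oa cX, mes_corner oa cY & mes_corner oa cD].
Proof.
have e : nat_of_ord (rev_ord oa) = n.-1 - oa by rewrite /=; lia.
by split; rewrite /mes_corner /fst /snd ?e !eqxx ?orbT.
Qed.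

Lemma mes_cornerP v : mes_corner oa v -> [\/ v = cA, v = cX, v = cY | v = cD].
Proof.
have e : nat_of_ord (rev_ord oa) = n.-1 - oa by rewrite /=; lia.
have E (x : 'I_n) : (x == oa :> nat) || (x == n.-1 - oa :> nat) ->
    x = oa \/ x = rev_ord oa.
  by case/orP => /eqP h; [left | right]; apply: val_inj; rewrite //= h -e.
by case: v => x y /andP [] /= /E [] -> /E [] ->; [constructor 1 | constructor 3
  | constructor 2 | constructor 4].
Qed.

Definition cornerB : node n := if side then cX else cD.
Definition cornerC : node n := if side then cD else cX.

Definition mirror (v : node n) : node n := (v.2, v.1).

Definition decr (i : 'I_n) : 'I_n := Ordinal (leq_ltn_trans (leq_pred i) (ltn_ord i)).

Definition decl (v : node n) : node n := (decr v.1, v.2).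
Definition decd (v : node n) : node n := (v.1, decr v.2).

(* For adjacent corners: first leave the half of B, then descend to the side AB,
   so that the weights below are monotone and the corner (a, n-1-a) is avoided.
   For opposite corners: stay strictly on one side of the diagonal AB, so that
   two mirror images can only meet on A. *)
Definition towards (v : node n) : node n :=
  if side then if (v.1.*2 < n) && (oa < v.2) then decd v else decl v
  else if v.1 < v.2 then if (v.1.+1 < v.2) || (v.1 == oa :> nat) then decd v else decl v
  else if v.2 < v.1 then if (v.2.+1 < v.1) || (v.2 == oa :> nat) then decl v else decd v
  else decl v.

(* Every symmetry exchanging A and B exchanges [wA] and [wB]. *)
Definition wA (v : node n) : nat :=
  if side then (v.1.*2 - n.-1) * (n - v.2) else v.1 + v.2.
Definition wB (v : node n) : nat :=
  if side then (n.-1 - v.1.*2) * (n - v.2) else n.-1.*2 - (v.1 + v.2).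

Definition SA (h : node n -> nat) := \sum_v h v * wA v.
Definition SB (h : node n -> nat) := \sum_v h v * wB v.

(* Lexicographic order: distance to A first, then a coordinate which determines
   the node, up to the reflection in AB when the corners are opposite. *)
Definition key (v : node n) : nat :=
  (v.1 + v.2) * n + (if side then v.1 : nat else minn v.1 v.2).

(** The disjunct with [f0] admits the start, where the sums may be equal; the strict inequality
    takes over once an inner robot has moved. *)
Definition is_phase1 (h : node n -> nat) : bool :=
  [&& h cA == 1, h cornerB == 1, h cY == 0, h cornerC == 0 &
      (SA h < SB h) || [forall v, h v == f0 v]].

Definition is_phase2 (h : node n -> nat) : bool :=
  [&& h cX < h cA, h cY < h cA & h cD < h cA].

Definition good h := is_phase1 h || is_phase2 h.

(** The threshold is the constant [K0] and not the current least key: a robot that has come closer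
    remains entitled to move, and no further inner robot joins in during phase 1. *)
Definition target (h : node n -> nat) (v : node n) : node n :=
  if v == cA then v
  else if [&& is_phase1 h, v != cornerB & K0 < key v] then v else towards v.

(** Without common coordinates, each robot searches the eight frames for one in which its snapshot
    is [good]. The adjacency test makes the rule valid on arbitrary input. *)
Definition galg : algorithm n := fun g u =>
  if [pick c : frame | good (fun w => g (fr c w))] is Some c then
    let d := fr c (target (fun w => g (fr c w)) (fr (fr_inv c) u)) in
    if adj u d then d else u
  else u.

Lemma galg_valid : valid_alg galg.
Proof.
move=> g u; rewrite /galg; case: pickP => [c _|_]; last by left.
by case: ifP; [right | left].
Qed.

Definition insq (v : node n) : bool :=
  (oa <= v.1 <= n.-1 - oa) && (oa <= v.2 <= n.-1 - oa).

(* The reflection in the diagonal through A may preserve the snapshot, so the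
   adversary can also impose the mirrored move. *)
Definition isstep (v d : node n) : Prop :=
  d = towards v \/ d = mirror (towards (mirror v)).

Definition isstep1 (v d : node n) : Prop :=
  d = towards v \/ (~~ side /\ d = mirror (towards (mirror v))).

Lemma isstep1W v d : isstep1 v d -> isstep v d.
Proof. by case=> [->|[_ ->]]; [left | right]. Qed.

(** The tie-breaking coordinate is less than [n], the contribution of one unit of distance. *)
Lemma key_lt (u v : node n) : u.1 + u.2 < v.1 + v.2 -> key u < key v.
Proof.
rewrite /key; have := ltn_ord u.1; have := ltn_ord u.2.
set x := u.1 + u.2; set y := v.1 + v.2 => h2 h1 h.
apply: (@leq_trans (x.+1 * n)); last first.
  by apply: leq_trans (leq_addr _ _); rewrite leq_mul2r h orbT.
by rewrite mulSn addnC ltn_add2r; case: side => //; rewrite gtn_min h1.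
Qed.

Lemma key_eq u v : key u = key v -> u = v \/ (~~ side /\ u = mirror v).
Proof.
move=> e.
have es : u.1 + u.2 = v.1 + v.2.
  by case: (ltngtP (u.1 + u.2) (v.1 + v.2)) => // /key_lt; rewrite e ltnn.
move: e; rewrite /key es => /addnI; case: side => e.
  by left; apply: node_eqP => //; nlia.
case: (leqP u.1 u.2) => h1; case: (leqP v.1 v.2) => h2.
- by left; apply: node_eqP; nlia.
- by right; split=> //; apply: node_eqP; nlia.
- by right; split=> //; apply: node_eqP; nlia.
- by left; apply: node_eqP; nlia.
Qed.

Hypothesis n_even : ~~ odd n.

Lemma rev_oa_neq : rev_ord oa <> oa.
Proof. by move=> /(congr1 val) /=; have := ltn_ord oa; lia. Qed.

Lemma cornerB_neq : cornerB <> cA.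
Proof. by rewrite /cornerB; case: side => -[] /rev_oa_neq. Qed.

Lemma mes_corner_cornerB : mes_corner oa cornerB.
Proof. by have [_ h _ h'] := mes_corners; rewrite /cornerB; case: side. Qed.

(** * Single steps towards A *)

Hypothesis a_small : oa.*2 + 3 < n.

Lemma towards_spec v : insq v -> v != cA ->
  [/\ adj v (towards v), insq (towards v),
      mes_corner oa (towards v) -> towards v = cA &
      (towards v).1 + (towards v).2 < v.1 + v.2].
Proof.
move=> iv vA.
have nA : ~ (v.1 = oa :> nat /\ v.2 = oa :> nat).
  by move=> [e1 e2]; move/eqP: vA; apply; apply: node_eqP.
have hA (w : node n) : w.1 = oa :> nat -> w.2 = oa :> nat -> w = cA.
  by move=> *; apply: node_eqP.
move: iv nA {vA}; rewrite /insq /towards adjE /adjn /mes_corner.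
case: v => [[x hx] [y hy]]; case: (oa) a_small hA => a ha /= a3 hA iv nA.
case: side; last first.
  case: ltnP => h1; first case: ifP => h2 /=.
  - split; try lia; move=> hc; apply: hA => /=; lia.
  - split; try lia; move=> hc; apply: hA => /=; lia.
  case: ltnP => h2; first case: ifP => h3 /=.
  - split; try lia; move=> hc; apply: hA => /=; lia.
  - split; try lia; move=> hc; apply: hA => /=; lia.
  by split=> /=; try lia; move=> hc; apply: hA => /=; lia.
case: ifP => h1 /=; split; try lia; move=> hc; apply: hA => /=; lia.
Qed.

Lemma isstep_spec v d : insq v -> v != cA -> isstep v d ->
  [/\ adj v d, insq d, mes_corner oa d -> d = cA & d.1 + d.2 < v.1 + v.2].
Proof.
move=> iv vA [->|->]; first exact: towards_spec.
have iv' : insq (mirror v) by move: iv; rewrite /insq /= andbC.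
have vA' : mirror v != cA.
  by apply: contra vA => /eqP [e1 e2]; apply/eqP; apply: node_eqP; rewrite ?e1 ?e2.
have [h1 h2 h3 h4] := towards_spec iv' vA'.
split.
- by move: h1; rewrite /adj /= orbC.
- by move: h2; rewrite /insq /= andbC.
- by move=> h; rewrite h3 //; move: h; rewrite /mes_corner /= andbC.
- by move: h4; rewrite /= addnC [_ + v.1]addnC.
Qed.

(** For adjacent corners, truncated subtraction makes [wA] vanish on the half of A and [wB] on the
    half of B. A step to the left lowers [wA] or raises [wB]; a step down in the half of A raises
    the factor [n - v.2] of [wB], whose cofactor is positive because [n] is even. *)
Lemma isstep1_weight v d : insq v -> v != cA -> isstep1 v d ->
  (wA d + wB v < wA v + wB d).
Proof.
move=> iv vA s1.
have [h1 h2 h3 h4] := isstep_spec iv vA (isstep1W s1).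
case sd : side s1 => s1; last first.
  rewrite /wA /wB sd.
  have := ltn_ord v.1; have := ltn_ord v.2; have := ltn_ord d.1; have := ltn_ord d.2.
  by nlia.
have {s1}-> : d = towards v by case: s1 => [//|[]]; rewrite sd.
have nA : ~ (v.1 = oa :> nat /\ v.2 = oa :> nat).
  by move=> [e1 e2]; move/eqP: vA; apply; apply: node_eqP.
move: iv nA {vA}; rewrite /insq /wA /wB /towards sd.
case: v {h1 h2 h3 h4} => [[x hx] [y hy]]; case: (oa) a_small => a ha /= a3 iv nA.
case: ifP => h1 /=.
  have -> : x.*2 - n.-1 = 0 by lia.
  rewrite !mul0n !add0n ltn_mul2l; lia.
case: (leqP n x.*2) => h2.
  have -> : n.-1 - x.*2 = 0 by lia.
  rewrite mul0n addn0; apply: leq_trans (leq_addr _ _).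
  rewrite ltn_mul2r; lia.
have -> : x.*2 - n.-1 = 0 by lia.
have -> : x.-1.*2 - n.-1 = 0 by lia.
rewrite !mul0n !add0n ltn_mul2r; lia.
Qed.

(** Next to the diagonal [towards] turns away from it, except beside A. This keeps mirror images
    apart until they reach A. *)
Lemma isstep1_side v d : ~~ side -> insq v -> v != cA -> isstep1 v d ->
  v.1 != v.2 -> d = cA \/ ((d.1 < d.2) = (v.1 < v.2) /\ (d.2 < d.1) = (v.2 < v.1)).
Proof.
move=> sd iv vA s1 v12.
(* Off the diagonal [towards] commutes with [mirror], so the mirrored step is the same step. *)
have {}s1 : d = towards v.
  case: s1 => [//|[_ ->]]; rewrite /mirror /towards (negbTE sd) /=.
  case: ltngtP v12 => [h _|h _|/val_inj ->]; last by rewrite eqxx.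
    by case: ifP; case: (v).
  by case: ifP; case: (v).
have hA (w : node n) : w.1 = oa :> nat -> w.2 = oa :> nat -> w = cA.
  by move=> *; apply: node_eqP.
have nA : ~ (v.1 = oa :> nat /\ v.2 = oa :> nat).
  by move=> [e1 e2]; move/eqP: vA; apply; apply: node_eqP.
have {}v12 : v.1 != v.2 :> nat by apply: contra v12.
rewrite {}s1; move: iv nA v12 {vA}; rewrite /insq /towards (negbTE sd).
case: v => [[x hx] [y hy]]; case: (oa) a_small hA => a ha /= a3 hA iv nA v12.
case: ltnP => h1; first case: ifP => h2 /=.
- have [e|e] := eqVneq y x.+1; first by left; apply: hA => /=; lia.
  by right; split; lia.
- by right; split; lia.
case: ltnP => h2; first case: ifP => h3 /=.
- have [e|e] := eqVneq x y.+1; first by left; apply: hA => /=; lia.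
  by right; split; lia.
- by right; split; lia.
by exfalso; lia.
Qed.

(** * Uniqueness of the leading corner *)

Lemma weight_swap c : fr c cA = cornerB -> fr c cornerB = cA ->
  (forall v : node n, wA (fr c v) = wB v) /\ (forall v : node n, wB (fr c v) = wA v).
Proof.
move=> h1 h2.
have := (congr1 (fun v : node n => val v.1) h1, congr1 (fun v : node n => val v.2) h1).
have := (congr1 (fun v : node n => val v.1) h2, congr1 (fun v : node n => val v.2) h2).
rewrite /cornerB /wA /wB {h1 h2}; case: (oa) a_small => a ha a3.
by case: c => [[[] []] []]; case: side => /= -[e1 e2] [e3 e4];
  (exfalso; lia) || (split=> -[[x hx] [y hy]] /=; lia || (congr (_ * _); lia)).
Qed.

Lemma SA_swap c h : fr c cA = cornerB -> fr c cornerB = cA ->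
  SA (fun v => h (fr c v)) = SB h /\ SB (fun v => h (fr c v)) = SA h.
Proof.
move=> h1 h2; have [e1 e2] := weight_swap h1 h2; rewrite /SA /SB.
split; rewrite [RHS](reindex_inj (@fr_inj n c)); apply: eq_bigr => v _.
  by rewrite e2.
by rewrite e1.
Qed.

Hypothesis f0_le : SA f0 <= SB f0.
Hypothesis f0_asym : forall c, fr c cA = cornerB -> fr c cornerB = cA ->
  ~ (forall v, f0 (fr c v) = f0 v).

(** The exchange swaps the two sums, so they cannot be strictly ordered in both frames. If just one
    view is [f0], then [f0_le] contradicts the strict inequality; if both are, the frame is a
    symmetry of [f0]. *)
Lemma phase1_swapF c h : is_phase1 h -> is_phase1 (fun v => h (fr c v)) ->
  fr c cA = cornerB -> fr c cornerB = cA -> False.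
Proof.
move=> /and5P [_ _ _ _ hh] /and5P [_ _ _ _ h'] e1 e2.
have [s1 s2] := SA_swap h e1 e2.
move: h'; rewrite s1 s2 => h'.
have f0E g : [forall v, g v == f0 v] -> SA g = SA f0 /\ SB g = SB f0.
  by move=> /forallP e; split; apply: eq_bigr => v _; rewrite (eqP (e v)).
have [e|e] := boolP [forall v, h v == f0 v].
  have [a1 a2] := f0E _ e.
  have [/forallP e'|e'] := boolP [forall v, h (fr c v) == f0 v].
    by apply: (f0_asym e1 e2) => v; rewrite -(eqP (e' v)) (eqP (forallP e _)).
  by move: h' f0_le; rewrite (negbTE e') orbF a1 a2; lia.
move: hh h'; rewrite (negbTE e) orbF => hh /orP [|/f0E [a1 a2]]; first lia.
by move: a1 a2; rewrite s1 s2; have := f0_le; lia.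
Qed.

(** In phase 1 exactly A and B are occupied, and they cannot be exchanged; in phase 2 A is the
    unique maximal corner. So the frame fixes A, and in phase 1 also B. Mixed phases are impossible,
    as phase 1 has two tied corners. *)
Lemma good_frame c h : good h -> good (fun v => h (fr c v)) ->
  is_phase1 h = is_phase1 (fun v => h (fr c v)) /\
  (c = (false, false, false) \/ (c = (true, false, false) /\ ~~ (is_phase1 h && side))).
Proof.
move=> g1 g2.
have p12 g : is_phase1 g -> is_phase2 g = false.
  move=> /and5P [/eqP h1 /eqP h2 /eqP h3 /eqP h4 _]; rewrite /is_phase2.
  by move: h1 h2 h3 h4; rewrite /cornerB /cornerC; case: side => -> -> -> ->.
case/orP: g1 => g1; case/orP: g2 => g2.
- rewrite g1 g2 /=; split=> //.
  move: (phase1_swapF g1 g2).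
  move: g1 g2 => /and5P [h1 h2 h3 h4 _] /and5P [].
  move: h1 h2 h3 h4; rewrite /cornerB /cornerC.
  by case: side; case: c => [[[] []] []] /=; rewrite ?rev_ordK; auto;
    move=> /eqP -> /eqP -> /eqP -> /eqP -> // *; exfalso; auto.
- exfalso; move: g2; rewrite /is_phase2.
  move: g1 => /and5P []; rewrite /cornerB /cornerC.
  by case: side; case: c => [[[] []] []] /=; rewrite ?rev_ordK;
    move=> /eqP -> /eqP -> /eqP -> /eqP ->.
- exfalso; move: g1; rewrite /is_phase2.
  move: g2 => /and5P []; rewrite /cornerB /cornerC.
  by case: side; case: c => [[[] []] []] /=; rewrite ?rev_ordK;
    move=> /eqP -> /eqP -> /eqP -> /eqP ->.
- have n1 : is_phase1 h = false by apply/negP => /p12; rewrite g1.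
  have n2 : is_phase1 (fun v => h (fr c v)) = false by apply/negP => /p12; rewrite g2.
  rewrite n1 n2; split=> //=.
  move: g1 g2; rewrite /is_phase2 => /and3P [h1 h2 h3] /and3P [].
  case: c {n2} => [[[] []] []] /=; rewrite ?rev_ordK => k1 k2 k3;
    by [left | right | exfalso; move: h1 h2 h3 k1 k2 k3; clear; lia].
Qed.

Lemma fr_mirror : @fr n (true, false, false) = mirror.
Proof. by []. Qed.

Lemma key_mirror v : ~~ side -> key (mirror v) = key v.
Proof. by rewrite /key => /negbTE ->; rewrite /= minnC [v.2 + v.1]addnC. Qed.

(** The frame of the adversary composed with the one found by the robot again gives a [good] view,
    so by [good_frame] it is the identity or [mirror]. *)
Lemma galg_spec (h : node n -> nat) (tau : node n -> node n) u :
  good h -> graph_aut tau -> insq (tau u) ->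
  let d := tau (galg (fun w => h (tau w)) u) in let p := tau u in
  if (p == cA) || [&& is_phase1 h, p != cornerB & K0 < key p] then d = p
  else if is_phase1 h then isstep1 p d else isstep p d.
Proof.
move=> gh tg iv /=; have n3 : 3 < n by move: a_small; lia.
rewrite /galg; case: pickP => [c gc|/(_ _)] ; last first.
  (* The search cannot fail: the inverse of [tau] restores the global view, which is [good]. *)
  have [t et] := graph_autP n3 tg.
  move=> /(_ (fr_inv t)); rewrite et.
  have -> : (fun w => h (fr t (fr (fr_inv t) w))) = h.
    by apply: functional_extensionality => w; rewrite fr_invK.
  by rewrite gh.
have rg : graph_aut (fun w => tau (fr c w)).
  by apply: graph_aut_comp tg _; exact: graph_aut_fr.
have [r er] := graph_autP n3 rg.
have erw w : tau (fr c w) = fr r w by rewrite -er.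
have hE : (fun w => h (tau (fr c w))) = (fun w => h (fr r w)).
  by apply: functional_extensionality => w; rewrite erw.
rewrite !hE in gc *.
have [ph rc] := good_frame gh gc.
set v := fr (fr_inv c) u.
have uv : tau u = fr r v by rewrite -erw /v fr_invK.
have [_ ta] := tg.
set d0 := fr c _.
have -> : tau (if adj u d0 then d0 else u) =
          if adj (tau u) (tau d0) then tau d0 else tau u.
  by rewrite ta; case: ifP.
rewrite uv in iv *; rewrite {}/d0 erw.
have tE : target (fun w => h (fr r w)) v =
    if (v == cA) || [&& is_phase1 h, v != cornerB & K0 < key v] then v else towards v.
  by rewrite /target -ph; case: ifP => //= ->.
rewrite tE.
move: rc iv; case=> [->|[-> ns]].
  have -> : fr (false, false, false) v = v by case: (v).
  move=> iv.
  have -> (w : node n) : fr (false, false, false) w = w by case: w.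
  have [h1|h1] := boolP ((v == cA) || _); first by rewrite if_same.
  move/norP: h1 => [vA _].
  have [-> _ _ _] := towards_spec iv vA.
  by case: ifP => _; left.
rewrite fr_mirror => iv.
have vE : (mirror v == cA) = (v == cA).
  by rewrite /mirror !xpair_eqE andbC.
have bE : [&& is_phase1 h, mirror v != cornerB & K0 < key (mirror v)] =
          [&& is_phase1 h, v != cornerB & K0 < key v].
  case: (is_phase1 h) ns => //= sd; rewrite key_mirror // /cornerB (negbTE sd).
  by congr (~~ _ && _); rewrite /mirror !xpair_eqE andbC.
rewrite vE bE; have [h1|h1] := boolP ((v == cA) || _); first by rewrite if_same.
move/norP: h1 => [vA _].
have mm : mirror (mirror v) = v by case: (v).
have st : isstep (mirror v) (mirror (towards v)) by right; rewrite mm.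
have vA' : mirror v != cA by rewrite vE.
have [-> _ _ _] := isstep_spec iv vA' st.
case: (is_phase1 h) ns => //= sd; by right; split=> //; rewrite mm.
Qed.

End Algorithm.

(** * Counting robots on a node *)

Section Config.

Variables n k : nat.
Implicit Types (p : 'I_k -> node n) (v : node n).

Lemma config_eq0 p v : (forall j, p j <> v) -> config p v = 0.
Proof.
move=> h; rewrite /config; apply/eqP; rewrite eqn_leq leq0n andbT geq_min.
by apply/orP; right; rewrite leqn0 cards_eq0; apply/eqP/setP => j; rewrite !inE; apply/eqP.
Qed.

Lemma config_eq1 p v i : p i = v -> (forall j, p j = v -> j = i) -> config p v = 1.
Proof.
move=> h1 h2; rewrite /config (_ : [set _ | _] = [set i]) ?cards1 //.
by apply/setP => j; rewrite !inE; apply/eqP/eqP => [/h2|->].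
Qed.

Lemma config_eq2 p v i j : p i = v -> p j = v -> i <> j -> config p v = 2.
Proof.
move=> h1 h2 /eqP h3; rewrite /config; apply/minn_idPl.
apply: (@leq_trans #|[set i; j]|); first by rewrite cards2 h3.
apply: subset_leq_card.
by apply/subsetP => l; rewrite !inE => /orP [] /eqP ->; apply/eqP.
Qed.

(** On distinct nodes the truncation at 2 is never reached, and sums over nodes become sums over
    robots. *)
Lemma sum_config p (w : node n -> nat) : injective p ->
  \sum_v config p v * w v = \sum_i w (p i).
Proof.
move=> ip.
transitivity (\sum_v \sum_i (p i == v) * w v).
  apply: eq_bigr => v _; rewrite -big_distrl /=; congr (_ * _).
  have [[i hi]|h] := classic (exists i, p i = v).
    rewrite (config_eq1 hi); last by move=> j hj; apply: ip; rewrite hi.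
    rewrite (bigD1 i) //= hi eqxx big1 // => j ji.
    by rewrite -hi (inj_eq ip) (negbTE ji).
  rewrite config_eq0; last by move=> j hj; apply: h; exists j.
  by rewrite big1 // => j _; case: eqP => // hj; case: h; exists j.
rewrite exchange_big /=; apply: eq_bigr => i _.
rewrite (bigD1 (p i)) //= eqxx mul1n big1 ?addn0 // => v hv.
by rewrite eq_sym (negbTE hv).
Qed.

End Config.

(** * Executions from a canonical initial configuration *)

Section Execution.

Variables (n k : nat) (oa : 'I_n) (side : bool) (pos0 : 'I_k -> node n).
Variables (iA iB r : 'I_k).

Local Notation cA := ((oa, oa) : node n).
Local Notation cB := (cornerB oa side).
Local Notation cX := ((rev_ord oa, oa) : node n).
Local Notation cY := ((oa, rev_ord oa) : node n).
Local Notation cD := ((rev_ord oa, rev_ord oa) : node n).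
Local Notation f0 := (config pos0).
Local Notation key := (@key n side).
Local Notation K0 := (key (pos0 r)).
Local Notation insq := (insq oa).
Local Notation isstep := (isstep oa side).
Local Notation isstep1 := (isstep1 oa side).
Local Notation wA := (@wA n side).
Local Notation wB := (@wB n side).
Local Notation phase1 := (is_phase1 oa side f0).
Local Notation phase2 := (@is_phase2 n oa).

Hypothesis n_even : ~~ odd n.
Hypothesis a_small : oa.*2 + 3 < n.
Hypothesis inj0 : injective pos0.
Hypothesis posA : pos0 iA = cA.
Hypothesis posB : pos0 iB = cB.
Hypothesis sq0 : forall i, insq (pos0 i).
Hypothesis corner0 : forall i, mes_corner oa (pos0 i) -> i = iA \/ i = iB.
Hypothesis rA : r <> iA.
Hypothesis rB : r <> iB.
Hypothesis rmin : forall i, i <> iA -> i <> iB -> K0 <= key (pos0 i).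
Hypothesis f0_le : SA side f0 <= SB side f0.
Hypothesis f0_asym : forall c, fr c cA = cB -> fr c cB = cA ->
  ~ (forall v, f0 (fr c v) = f0 v).

(* Both initial corner robots are still alone on their corners; no robot ever
   arrives at B, so this can only be lost, never regained. *)
Definition early (p : 'I_k -> node n) : Prop :=
  p iB = cB /\ forall i, p i = cA -> i = iA.

(** A robot that has decided to stay still carries a pending move to its own node. *)
Definition resting (s : state n k) i : Prop :=
  pos s i = pos0 i /\ forall d, pend s i = Some d -> d = pos s i.

(** Meant for the inner robots of least initial key: they stay entitled, shift weight in favour of
    A, and for opposite corners keep to their side of the diagonal. *)
Definition climbing (s : state n k) i : Prop :=
  [/\ key (pos s i) <= K0,
      pos s i = pos0 i \/ wA (pos s i) + wB (pos0 i) < wA (pos0 i) + wB (pos s i),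
      ~~ side -> (pos0 i).1 != (pos0 i).2 ->
        ((pos s i).1 < (pos s i).2) = ((pos0 i).1 < (pos0 i).2) /\
        ((pos s i).2 < (pos s i).1) = ((pos0 i).2 < (pos0 i).1) &
      forall d, pend s i = Some d -> d = pos s i \/ isstep1 (pos s i) d].

(** A pending move may be performed in a later phase than that of its snapshot, so [inv_pend]
    records only that it is a possibly mirrored step from the present node. *)
Record invariant (s : state n k) : Prop := Invariant {
  invA : pos s iA = cA;
  inv_sq : forall i, insq (pos s i);
  inv_corner : forall i, mes_corner oa (pos s i) ->
    pos s i = cA \/ i = iB /\ pos s i = cB;
  inv_pend : forall i d, pend s i = Some d ->
    d = pos s i \/ pos s i != cA /\ isstep (pos s i) d;
  inv_early : early (pos s) -> forall i, i <> iA -> i <> iB ->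
    if K0 < key (pos0 i) then resting s i else climbing s i }.

(** Resting robots keep distinct initial nodes of key above [K0], climbing ones have key at most
    [K0]. Two climbing robots start with equal keys, hence at mirror images, and the diagonal
    separates them. *)
Lemma early_inj s : invariant s -> early (pos s) -> injective (pos s).
Proof.
move=> I [eB eA] i j e.
have [iEA|iA'] := classic (i = iA).
  by rewrite [RHS]eA // -e iEA (invA I).
have [jEA|jA'] := classic (j = iA).
  by case: iA'; apply: eA; rewrite e jEA (invA I).
have ncB l : l <> iA -> l <> iB -> pos s l <> cB.
  move=> lA lB h.
  have hc : mes_corner oa (pos s l) by rewrite h (mes_corner_cornerB oa side).
  have [h'|[]//] := inv_corner I hc.
  by apply: lA; apply: eA.
have [iEB|iB'] := classic (i = iB).
  have [->//|jB'] := classic (j = iB).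
  by case: (ncB j jA' jB'); rewrite -e iEB.
have [jEB|jB'] := classic (j = iB).
  by case: (ncB i iA' iB'); rewrite e jEB.
have hi := inv_early I (conj eB eA) iA' iB'.
have hj := inv_early I (conj eB eA) jA' jB'.
move: hi hj; case: ltnP => ki; case: ltnP => kj.
- by move=> [ei _] [ej _]; apply: inj0; rewrite -ei -ej.
- by move=> [ei _] [ej _ _ _]; exfalso; move: ej; rewrite -e ei; lia.
- by move=> [ei _ _ _] [ej _]; exfalso; move: ei; rewrite e ej; lia.
move=> [_ _ si _] [_ _ sj _].
have ke : key (pos0 i) = key (pos0 j).
  by have := rmin iA' iB'; have := rmin jA' jB'; lia.
case: (key_eq ke) => [/inj0 //|[sd m]].
have [d|d] := eqVneq (pos0 i).1 (pos0 i).2.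
  apply: inj0; rewrite m; move: d; rewrite m /=.
  by case: (pos0 j) => x y /= ->.
have d' : (pos0 j).1 != (pos0 j).2.
  by apply: contra d; rewrite m /= eq_sym.
have [a1 a2] := si sd d; have [b1 b2] := sj sd d'.
have {}d' : (pos0 j).1 != (pos0 j).2 :> nat by apply: contra d'.
by exfalso; move: a1 a2 b1 b2 d'; rewrite m e /=; lia.
Qed.

(** Positions are distinct, so both sums run over robots. If nobody has moved the snapshot is [f0];
    otherwise the initial inequality has become strict. *)
Lemma early_phase1 s : invariant s -> early (pos s) -> phase1 (config (pos s)).
Proof.
move=> I e; have ip := early_inj I e; have [eB eA] := e.
have empty v : mes_corner oa v -> v <> cA -> v <> cB -> config (pos s) v = 0.
  move=> hv vA vB; apply: config_eq0 => j hj.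
  rewrite -hj in hv.
  by case: (inv_corner I hv) => [|[_]]; rewrite hj.
have [c1 c2 c3 c4] := mes_corners oa.
apply/and5P; split.
- by rewrite (config_eq1 (invA I)).
- by rewrite (config_eq1 eB) // => j hj; apply: ip; rewrite eB.
- rewrite empty //; first by case=> /(rev_oa_neq n_even).
  by rewrite /cornerB; case: side => -[] => [/esym /(rev_oa_neq n_even)|/esym /(rev_oa_neq n_even)].
- rewrite /cornerC; case sd : side; rewrite empty //; try by case=> /(rev_oa_neq n_even).
    by rewrite /cornerB sd => -[] /(rev_oa_neq n_even).
  by rewrite /cornerB sd => -[] /esym /(rev_oa_neq n_even).
have [h|h] := classic (forall i, pos s i = pos0 i).
  apply/orP; right; apply/forallP => v; apply/eqP; congr config.
  exact: functional_extensionality.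
have [j hj] := not_all_ex_not _ _ h.
apply/orP; left; move: f0_le.
rewrite /SA /SB !sum_config // => le0.
have mono i : pos s i = pos0 i \/
    wA (pos s i) + wB (pos0 i) < wA (pos0 i) + wB (pos s i).
  have [->|a'] := classic (i = iA); first by left; rewrite (invA I).
  have [->|b'] := classic (i = iB); first by left; rewrite eB.
  by have := inv_early I e a' b'; case: ifP => _ []; auto.
have lt : \sum_i (wA (pos s i) + wB (pos0 i)) < \sum_i (wA (pos0 i) + wB (pos s i)).
  rewrite (bigD1 j) //= [X in _ < X](bigD1 j) //= -addSn; apply: leq_add.
    by case: (mono j).
  apply: leq_sum => i _; case: (mono i) => [->|/ltnW //].
  by rewrite leqnn.
by move: le0 lt; rewrite !big_split /=; lia.
Qed.

(** Either B has been left, and A is the only occupied corner, or A has become a multiplicity while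
    B holds at most one robot. *)
Lemma late_phase2 s : invariant s -> ~ early (pos s) -> phase2 (config (pos s)).
Proof.
move=> I ne.
have [c1 c2 c3 c4] := mes_corners oa.
have empty v : mes_corner oa v -> v <> cA -> v <> cB -> config (pos s) v = 0.
  move=> hv vA vB; apply: config_eq0 => j hj.
  rewrite -hj in hv.
  by case: (inv_corner I hv) => [|[_]]; rewrite hj.
have pA : 0 < config (pos s) cA.
  have [h|h] := classic (forall i, pos s i = cA -> i = iA).
    by rewrite (config_eq1 (invA I) h).
  have [j hj] := not_all_ex_not _ _ h.
  have [h1 h2] := imply_to_and _ _ hj.
  by rewrite (config_eq2 h1 (invA I) h2).
have ltB : config (pos s) cB < config (pos s) cA.
  have onlyB j : pos s j = cB -> j = iB.
    move=> hj; have hc : mes_corner oa (pos s j) by rewrite hj (mes_corner_cornerB oa side).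
    have [h|[]//] := inv_corner I hc.
    by case: (@cornerB_neq n oa side n_even); exact: etrans (esym hj) h.
  have [eB|nB] := classic (pos s iB = cB); last first.
    rewrite [X in X < _]config_eq0 // => j hj; apply: nB.
    by rewrite -(onlyB _ hj).
  rewrite (config_eq1 eB onlyB).
  have [h|h] := classic (forall i, pos s i = cA -> i = iA); first by case: ne.
  have [j hj] := not_all_ex_not _ _ h.
  have [h1 h2] := imply_to_and _ _ hj.
  by rewrite (config_eq2 h1 (invA I) h2).
have lt v : mes_corner oa v -> v <> cA -> config (pos s) v < config (pos s) cA.
  move=> hv vA; have [->//|vB] := classic (v = cB).
  by rewrite empty.
by apply/and3P; split; apply: lt => // -[] /(rev_oa_neq n_even).
Qed.

Lemma phase1E s : invariant s -> phase1 (config (pos s)) <-> early (pos s).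
Proof.
move=> I; split; last exact: early_phase1.
move=> p1; apply: NNPP => ne; move: p1 (late_phase2 I ne).
rewrite /is_phase1 /is_phase2 /cornerB /cornerC.
by case: side => /and5P [/eqP -> /eqP -> /eqP -> /eqP -> _].
Qed.

Lemma invariant_good s : invariant s -> good oa side f0 (config (pos s)).
Proof.
move=> I; apply/orP; have [e|e] := classic (early (pos s)).
  by left; exact: early_phase1.
by right; exact: late_phase2.
Qed.

Local Notation alg := (galg oa side K0 f0).

Definition active (s : state n k) i : Prop :=
  pos s i <> cA /\ (early (pos s) -> i = iB \/ key (pos s i) <= K0).

Lemma look_spec s tau u i : invariant s -> graph_aut tau -> tau u = pos s i ->
  let d := tau (alg (fun w => config (pos s) (tau w)) u) in
  (active s i /\ isstep (pos s i) d /\ (early (pos s) -> isstep1 (pos s i) d)) \/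
  (~ active s i /\ d = pos s i).
Proof.
move=> I tg e /=.
have := @galg_spec n oa side K0 f0 n_even a_small f0_le f0_asym _ tau u
  (invariant_good I) tg.
rewrite e => /(_ (inv_sq I i)) /=; move: (tau (galg _ _ _ _ _ _)) => d.
have ncB : early (pos s) -> pos s i = cB -> i = iB.
  move=> er h; apply: (early_inj I er); rewrite h; by case: er.
case: ifP => [/orP [/eqP h|/and3P [h1 /eqP h2 h3]] ->|/negbT /norP [/eqP h1 h2]].
- by right; split=> // -[].
- right; split=> // -[_ /(_ (proj1 (phase1E I) h1)) [ib|]]; last by lia.
  by apply: h2; rewrite ib; case: (proj1 (phase1E I) h1).
move=> st; left; split.
  split=> // er; have := early_phase1 I er.
  move: h2 => /[swap] ->; rewrite /= => h2.
  have [b|b] := eqVneq (pos s i) cB; first by left; exact: ncB.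
  by right; move: h2; rewrite b /= -leqNgt.
move: st; case: ifP => p1 st.
  by split=> //; exact: isstep1W.
by split=> // /(early_phase1 I); rewrite p1.
Qed.

Lemma move_step s i d : invariant s -> pend s i = Some d ->
  [/\ insq d, mes_corner oa d -> d = cA \/ i = iB /\ d = cB,
      d = pos s i \/ d.1 + d.2 < (pos s i).1 + (pos s i).2,
      d = cB -> pos s i = cB & pos s i = cA -> d = cA].
Proof.
move=> I pd; case: (inv_pend I pd) => [->|[nA st]].
  by split=> //; [exact: inv_sq | exact: inv_corner | left].
have [h1 h2 h3 h4] := isstep_spec n_even a_small (inv_sq I i) nA st.
split=> //; [by left; apply: h3 | by right | | by move=> h; rewrite h eqxx in nA].
move=> dB; case: (@cornerB_neq n oa side n_even); rewrite -[LHS]dB; apply: h3; rewrite dB.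
exact: (mes_corner_cornerB oa side).
Qed.

Lemma invariant_step cr s e s' : invariant s -> step alg cr s e s' ->
  invariant s' /\
  (forall i, pos s' i = pos s i \/
     (pos s' i).1 + (pos s' i).2 < (pos s i).1 + (pos s i).2).
Proof.
move=> I; case: e => [i tau u|i] /=.
  move=> [[ci pi tg ti ps] pe].
  have lk := look_spec I tg ti; simpl in lk.
  have psE : pos s' = pos s by exact: functional_extensionality.
  split; last by move=> j; left.
  split; rewrite ?psE; try by case: I.
    move=> j d; rewrite pe; case: eqP => [-> [<-]|_]; last exact: inv_pend.
    by case: lk => [[[/eqP a1 _] [a2 _]]|[_ ->]]; auto.
  move=> er j jA jB; have := inv_early I er jA jB.
  case: ltnP => kj; rewrite /resting /climbing psE.
    move=> [e1 e2]; split=> // d; rewrite pe; case: eqP => [ji [<-]|_]; last exact: e2.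
    case: lk => [[[_ /(_ er) a1] _]|[_ -> //]]; last by rewrite ji.
    by exfalso; case: a1 => [|]; rewrite -ji // e1; lia.
  move=> [e1 e2 e3 e4]; split=> // d; rewrite pe; case: eqP => [ji [<-]|_]; last exact: e4.
  by rewrite ji; case: lk => [[_ [_ /(_ er)]]|[_ ->]]; auto.
move=> [ci [d [pd ps pe]]].
have [d1 d2 d3 d4 d5] := move_step I pd.
split; last by move=> j; rewrite ps; case: eqP => [->|_]; [| left].
have iAA : i = iA -> d = cA by move=> ei; apply: d5; rewrite ei (invA I).
split.
- by rewrite ps; case: eqP => [/esym /iAA|_] //; exact: invA.
- by move=> j; rewrite ps; case: eqP => // _; exact: inv_sq.
- by move=> j; rewrite ps; case: eqP => [->|_] //; exact: inv_corner.
- by move=> j d'; rewrite pe ps; case: eqP => // _; exact: inv_pend.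
move=> [eB eA] j jA jB.
(* The old state was early too: B is never entered from elsewhere and A is never left. *)
have er : early (pos s).
  split.
    by move: eB; rewrite ps; case: eqP => [->|_ //]; exact: d4.
  move=> l hl; apply: eA; rewrite ps; case: eqP => // li.
  by apply: d5; rewrite -li.
have := inv_early I er jA jB; rewrite /resting /climbing ps pe.
case: (j =P i) => [ij|//]; rewrite -ij in pd d1 d2 d3 d4 d5 *.
have dA : d <> cA by move=> h; apply: jA; apply: eA; rewrite ps -ij eqxx.
have pA : pos s j != cA by apply/eqP => /d5.
case: ltnP => kj.
  by move=> [e1 e2]; split=> //; rewrite (e2 _ pd).
move=> [e1 e2 e3 e4]; case: (e4 _ pd) => [->|st]; first by split.
have [s1 s2 s3 s4] := isstep_spec n_even a_small (inv_sq I j) pA (isstep1W st).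
split=> //.
- by apply: leq_trans e1; apply: ltnW; exact: key_lt.
- right; have := isstep1_weight n_even a_small (inv_sq I j) pA st.
  by case: e2 => [->//|]; lia.
- move=> sd nd; have [a1 a2] := e3 sd nd.
  have nd' : (pos s j).1 != (pos s j).2.
    apply: contra nd => /eqP h; move: a1 a2; rewrite h !ltnn => a1 a2.
    by apply/eqP; apply: val_inj; move: a1 a2 => /=; lia.
  have [//|[b1 b2]] := isstep1_side n_even a_small sd (inv_sq I j) pA st nd'.
  by rewrite b1 b2.
Qed.

(** * Termination *)

Lemma nonincreasing_stationary (u : nat -> nat) :
  (forall t, u t.+1 <= u t) -> exists T, forall t, T <= t -> u t = u T.
Proof.
move=> mono.
have mono' t t' : t <= t' -> u t' <= u t.
  by move=> /subnK <-; elim: (t' - t) => [//|m IH]; apply: leq_trans (mono _) IH.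
suff H m t0 : u t0 <= m -> exists T, forall t, T <= t -> u t = u T by exact: (H _ 0).
elim: m t0 => [|m IH] t0 h0.
  by exists t0 => t /mono'; lia.
have [[t [le lt]]|h] := classic (exists t, t0 <= t /\ u t < u t0).
  by apply: (IH t); lia.
exists t0 => t le; apply/eqP; rewrite eqn_leq mono' //= leqNgt.
by apply/negP => lt; apply: h; exists t.
Qed.

(** Once positions are constant, every active robot is the crash victim. A correct robot off A would
    be active in a late state, so the state is early; but then the robots [iB] and [r] are both
    active, and only one can crash. *)
Lemma canonical_gatherable : gatherable_1crash pos0.
Proof.
exists alg; split; first exact: galg_valid.
move=> crash s e [E0 E1 E2].
have inv t : invariant (s t).
  elim: t => [|t IH]; last by have [] := invariant_step IH (E1 t).
  have p0 : pos (s 0) = pos0 by apply: functional_extensionality => i; case: (E0 i).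
  have pn i : pend (s 0) i = None by case: (E0 i).
  split; rewrite ?p0 //.
  - by move=> i /corner0 [->|->]; [left | right].
  - by move=> i d; rewrite pn.
  move=> _ i iA' iB'; case: ltnP => ki; rewrite /resting /climbing p0 pn; split=> //.
  by left.
(* Up to an additive constant this is the total distance to A, crashed robot included. *)
pose pot t := \sum_i ((pos (s t) i).1 + (pos (s t) i).2).
have le_pot t i : (pos (s t.+1) i).1 + (pos (s t.+1) i).2 <=
                  (pos (s t) i).1 + (pos (s t) i).2.
  by have [_ /(_ i) [->//|/ltnW]] := invariant_step (inv t) (E1 t).
have mono t : pot t.+1 <= pot t by apply: leq_sum => i _; exact: le_pot.
have [T0 cst] := nonincreasing_stationary mono.
have fixS t : T0 <= t -> pos (s t.+1) = pos (s t).
  move=> le; apply: functional_extensionality => i.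
  have [_ /(_ i) [//|lt]] := invariant_step (inv t) (E1 t).
  have : pot t.+1 = pot t by rewrite !cst //; lia.
  rewrite /pot (bigD1 i) //= [RHS](bigD1 i) //= => eq.
  have lt' : \sum_(j | j != i) ((pos (s t.+1) j).1 + (pos (s t.+1) j).2) <=
             \sum_(j | j != i) ((pos (s t) j).1 + (pos (s t) j).2).
    by apply: leq_sum => j _; exact: le_pot.
  by exfalso; move: eq lt lt' => /=; lia.
have fix_pos t : T0 <= t -> pos (s t) = pos (s T0).
  by move=> /subnK <-; elim: (t - T0) => [//|m <-]; rewrite addSn fixS // leq_addl.
(* An active robot computes a genuine move at its next Look. Fairness grants it yet another Look,
   possible only after that move is performed, against constancy of the positions. *)
have idle t i : T0 <= t -> ~~ crash_victim crash i -> ~ active (s t) i.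
  move=> le nv ac; have [t1 le1 l1] := E2 i nv T0.
  have ac1 : active (s t1) i by move: ac; rewrite /active !fix_pos.
  have [d nd pd] : exists2 d, d <> pos (s t1) i & pend (s t1.+1) i = Some d.
    have := E1 t1; move: l1; case: (e t1) => //= j tau u /eqP -> [[_ _ tg tu _] pe].
    have /= [[_ [st _]]|[]//] := look_spec (inv t1) tg tu.
    exists (tau (alg (fun w => config (pos (s t1)) (tau w)) u)); last by rewrite pe eqxx.
    have [/eqP nA _] := ac1.
    have [_ _ _ lt] := isstep_spec n_even a_small (inv_sq (inv t1) i) nA st.
    by move=> ed; rewrite ed ltnn in lt.
  have stuck t2 : t1 < t2 -> pend (s t2) i = Some d.
    move=> /subnK <-; elim: (t2 - t1.+1) => [//|m IH]; rewrite addSn.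
    set t3 := m + t1.+1 in IH *.
    have le3 : T0 <= t3 by rewrite /t3; lia.
    have := E1 t3; case: (e t3) => [j tau u|j] /=.
      move=> [[_ pn _ _ _] pe]; rewrite pe; case: eqP => // ij.
      by rewrite -ij IH in pn.
    move=> [_ [d' [pd' ps pe]]]; rewrite pe; case: eqP => // ij.
    move: pd'; rewrite -ij IH => -[dd]; case: nd.
    by have := ps i; rewrite ij eqxx -ij fixS // dd => <-; rewrite !fix_pos.
  have [t2 le2 l2] := E2 i nv t1.+1.
  have := E1 t2; move: l2; case: (e t2) => //= j tau u /eqP -> [[_ pn _ _ _] _].
  by rewrite stuck in pn.
(* Waiting for the crash as well makes being crashed the same as being the victim. *)
pose T := if crash is Some (_, tc) then maxn T0 tc else T0.
exists T, cA => t le i ni.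
have le0 : T0 <= t by move: le; rewrite /T; case: (crash) => [[c tc]|]; lia.
have nv : ~~ crash_victim crash i.
  move: le ni; rewrite /T /crashed_at /crash_victim; case: (crash) => [[c tc]|] //.
  by rewrite geq_max => /andP [_ ->]; rewrite andbT.
apply: NNPP => nA.
have er : early (pos (s t)).
  by apply: NNPP => ner; apply: (idle t i le0 nv); split.
have [eB eA] := er.
have vB : crash_victim crash iB.
  apply/negPn/negP => h; apply: (idle t iB le0 h); split; last by left.
  by rewrite eB; exact: (@cornerB_neq n oa side n_even).
have vr : crash_victim crash r.
  apply/negPn/negP => h; apply: (idle t r le0 h); split; first by move/eA.
  have := inv_early (inv t) er rA rB; rewrite ltnn => -[h1 _ _ _].
  by right.
move: vB vr; rewrite /crash_victim; case: (crash) => [[c tc]|] // /eqP -> /eqP.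
by move/esym.
Qed.

End Execution.

(** * Reduction to the canonical frame *)

Definition unswappable n k (p : 'I_k -> node n) (u w : node n) : Prop :=
  forall phi, graph_aut phi -> phi u = w -> phi w = u ->
    ~ (forall v, config p (phi v) = config p v).

Lemma unswappable_fr n k (p : 'I_k -> node n) u w c :
  unswappable p u w -> unswappable (fun i => fr c (p i)) (fr c u) (fr c w).
Proof.
move=> ns phi pg e1 e2 h; apply: (ns (fun v => fr (fr_inv c) (phi (fr c v)))).
- apply: graph_aut_comp; first exact: graph_aut_fr.
  by apply: graph_aut_comp => //; exact: graph_aut_fr.
- by rewrite e1 frK.
- by rewrite e2 frK.
move=> v; have := h (fr c v).
rewrite [RHS]config_comp; last exact: fr_inj.
by rewrite -{1}(fr_invK c (phi _)) config_comp //; exact: fr_inj.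
Qed.

Lemma unswappableC n k (p : 'I_k -> node n) u w : unswappable p u w -> unswappable p w u.
Proof. by move=> ns phi pg e1 e2; exact: ns. Qed.

Lemma insq_fr n (oa : 'I_n) c v : insq oa (fr c v) = insq oa v.
Proof.
rewrite /insq; case: v => [[x hx] [y hy]]; case: (oa) => a ha.
by case: c => [[[] []] []] /=; lia.
Qed.

Lemma mes_corner_fr n (oa : 'I_n) c (v : node n) :
  mes_corner oa (fr c v) = mes_corner oa v.
Proof.
rewrite /mes_corner; case: v => [[x hx] [y hy]]; case: (oa) => a ha.
by case: c => [[[] []] []] /=; lia.
Qed.

Section Reduction.

Variables (n k : nat) (oa : 'I_n).
Hypothesis n_even : ~~ odd n.
Hypothesis a_small : oa.*2 + 3 < n.

Lemma weighted_gatherable side (p : 'I_k -> node n) iA iB j :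
  injective p -> p iA = (oa, oa) -> p iB = cornerB oa side ->
  (forall i, insq oa (p i)) ->
  (forall i, mes_corner oa (p i) -> i = iA \/ i = iB) ->
  j <> iA -> j <> iB -> unswappable p (oa, oa) (cornerB oa side) ->
  SA side (config p) <= SB side (config p) -> gatherable_1crash p.
Proof.
move=> ip pA pB sq cor /eqP jA /eqP jB ns le.
have jj : (j != iA) && (j != iB) by rewrite jA.
case: (@arg_minnP _ j (fun i => (i != iA) && (i != iB)) (fun i => key side (p i)) jj).
move=> r /andP [/eqP rA /eqP rB] rmin.
apply: (@canonical_gatherable n k oa side p iA iB r) => //.
  by move=> i /eqP iA' /eqP iB'; apply: rmin; rewrite iA'.
by move=> c e1 e2; apply: ns => //; exact: graph_aut_fr.
Qed.

(** Either corner can play the role of A; if the sums are in the wrong order, an involution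
    exchanging the corners corrects it. *)
Lemma cornered_gatherable side (p : 'I_k -> node n) iA iB j :
  injective p -> p iA = (oa, oa) -> p iB = cornerB oa side ->
  (forall i, insq oa (p i)) ->
  (forall i, mes_corner oa (p i) -> i = iA \/ i = iB) ->
  j <> iA -> j <> iB -> unswappable p (oa, oa) (cornerB oa side) ->
  gatherable_1crash p.
Proof.
move=> ip pA pB sq cor jA jB ns.
have [le|lt] := leqP (SA side (config p)) (SB side (config p)).
  exact: (weighted_gatherable ip pA pB sq cor jA jB).
(* An axis reflection for adjacent corners, the half-turn for opposite ones. *)
pose c : frame := if side then (false, true, false) else (false, true, true).
have e1 : fr c (oa, oa) = cornerB oa side by rewrite /c /cornerB; case: (side).
have e2 : fr c (cornerB oa side) = (oa, oa).
  by rewrite /c /cornerB; case: (side); rewrite /fr /= ?rev_ordK.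
have cI : fr_inv c = c by rewrite /c; case: (side).
apply: (gatherable_transport (graph_aut_fr n c)).
apply: (@weighted_gatherable side _ iB iA j).
- by move=> i i' /fr_inj /ip.
- by rewrite pB.
- by rewrite pA.
- by move=> i; rewrite insq_fr.
- by move=> i; rewrite mes_corner_fr => /cor [->|->]; [right | left].
- by [].
- by [].
- by have := unswappable_fr (c := c) (unswappableC ns); rewrite e1 e2.
have -> : config (fun i => fr c (p i)) = fun v => config p (fr c v).
  apply: functional_extensionality => v.
  rewrite -{1}(fr_invK c v) config_comp ?cI //; exact: fr_inj.
have [-> ->] := SA_swap n_even a_small (config p) e1 e2.
exact: ltnW.
Qed.

Lemma corner_frame (u w : node n) :
  mes_corner oa u -> mes_corner oa w -> u <> w ->
  exists c side, fr c u = (oa, oa) /\ fr c w = cornerB oa side.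
Proof.
move=> /mes_cornerP hu /mes_cornerP hw uw.
have X c side : fr c u = (oa, oa) -> fr c w = cornerB oa side ->
  exists c side, fr c u = (oa, oa) /\ fr c w = cornerB oa side by exists c, side.
case: hu uw X => -> uw X; case: hw uw X => -> // _ X.
- by apply: (X (false, false, false) true).
- by apply: (X (true, false, false) true).
- by apply: (X (false, false, false) false).
- by apply: (X (false, true, false) true); rewrite /fr /= ?rev_ordK.
- by apply: (X (false, true, false) false); rewrite /fr /= ?rev_ordK.
- by apply: (X (true, false, true) true); rewrite /fr /= ?rev_ordK.
- by apply: (X (true, true, false) true); rewrite /fr /= ?rev_ordK.
- by apply: (X (false, false, true) false); rewrite /fr /= ?rev_ordK.
- by apply: (X (false, false, true) true); rewrite /fr /= ?rev_ordK.
- by apply: (X (false, true, true) false); rewrite /fr /= ?rev_ordK.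
- by apply: (X (true, true, true) true); rewrite /fr /= ?rev_ordK.
- by apply: (X (false, true, true) true); rewrite /fr /= ?rev_ordK.
Qed.

End Reduction.

(** * Symmetries exchanging the two occupied corners *)

Lemma partitive_frame n (f : node n -> nat) (c : frame) : ~~ odd n ->
  c \in [:: (false, true, false); (false, false, true); (false, true, true);
            (true, true, false); (true, false, true)] ->
  (forall v, f (fr c v) = f v) -> partitive f.
Proof.
move=> ne hc inv.
have noteq (u v : node n) : ((u.1 != v.1 :> nat) || (u.2 != v.2 :> nat)) -> u <> v.
  by move=> h e; rewrite e !eqxx in h.
(* The frames with an exchange in the list are quarter turns, of order 4. As [n] is even there is no
   middle row or column to be fixed. *)
exists (fr c), (if c.1.1 then 4 else 2); split=> //.
- exact: graph_aut_fr.
- by case: ifP.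
- move=> v; move: hc; rewrite !inE.
  by do 4?[case/orP]; move=> /eqP ->; case: v => x y; rewrite /= /fr /= ?rev_ordK.
move=> v m hm; apply: noteq; move: hc hm; rewrite !inE.
case: v => [[x hx] [y hy]].
do 4?[case/orP]; move=> /eqP -> /= hm.
- have -> : m = 1 by lia.
  by rewrite /=; lia.
- have -> : m = 1 by lia.
  by rewrite /=; lia.
- have -> : m = 1 by lia.
  by rewrite /=; lia.
- have [->|[->|->]] : m = 1 \/ m = 2 \/ m = 3 by lia.
  + by rewrite /=; lia.
  + by rewrite /=; lia.
  + by rewrite /=; lia.
- have [->|[->|->]] : m = 1 \/ m = 2 \/ m = 3 by lia.
  + by rewrite /=; lia.
  + by rewrite /=; lia.
  + by rewrite /=; lia.
Qed.

(** Five of the eight symmetries would make the configuration partitive and the identity exchanges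
    nothing; a diagonal reflection exchanging the corners is the 2S2 case. *)
Lemma no_swap n k (p : 'I_k -> node n) a u w :
  ~~ odd n -> 3 < n -> ~ partitive (config p) -> ~ is_2S2 (config p) ->
  is_mes (config p) a -> occ_corners (config p) a = [set u; w] -> u <> w ->
  unswappable p u w.
Proof.
move=> ne n3 np n2 hm oc uw phi pg e1 e2 inv.
have [c ec] := graph_autP n3 pg; rewrite {}ec {pg phi} in e1 e2 inv.
have uo : u \in occ_corners (config p) a by rewrite oc !inE eqxx.
have wo : w \in occ_corners (config p) a by rewrite oc !inE eqxx orbT.
have [|hc] := boolP (c \in [:: (false, true, false); (false, false, true);
  (false, true, true); (true, true, false); (true, false, true)]).
  by move=> hc; apply: np; exact: (partitive_frame ne hc).
have fixc rho : rho = @refl_main n \/ rho = @refl_anti n -> rho u = w -> rho w = u ->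
    (forall v, config p (rho v) = config p v) -> is_2S2 (config p).
  move=> hr r1 r2 rinv.
  have uw' : ~ (u.1 = w.1 :> nat /\ u.2 = w.2 :> nat).
    by move=> [h1 h2]; apply: uw; apply: node_eqP.
  have cu : mes_corner a u by move: uo; rewrite inE => /andP [].
  have cw : mes_corner a w by move: wo; rewrite inE => /andP [].
  exists a; split=> //.
  - by rewrite oc cards2; move/eqP: uw => ->.
  - exists u, w; split=> //; apply/eqP => /(congr1 val) /= h;
    move: uw' cu cw h; rewrite -r1; case: hr => ->; case: (u) => [[x hx] [y hy]];
    rewrite /mes_corner /=; lia.
  (* A diagonal reflection exchanges one pair of opposite corners and fixes the other pair, here the
     unoccupied one. *)
  exists rho; split=> // v cv fv.
  have vu : v <> u by move=> vu; move: uo; rewrite inE -vu fv eqxx andbF.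
  have vw : v <> w by move=> vw; move: wo; rewrite inE -vw fv eqxx andbF.
  have an : a < n by case: hm => h _ _; lia.
  move: uw vu vw; rewrite -r1.
  case: (@mes_cornerP _ (Ordinal an) _ cu) => ->;
  case: (@mes_cornerP _ (Ordinal an) _ cv) => ->;
  case: hr => ->; rewrite /refl_main /refl_anti /fst /snd ?rev_ordK => h1 h2 h3;
  by [] || by case: h1 || by case: h2 || by case: h3.
case: c hc e1 e2 inv => [[[] []] []] // _ e1 e2 inv.
- by apply: n2; apply: (fixc (@refl_anti n)) => //; right.
- by apply: n2; apply: (fixc (@refl_main n)) => //; left.
- by apply: uw; rewrite -e1; case: (u).
Qed.

Theorem theorem8 (n k : nat) (pos0 : 'I_k -> node n) :
  ~~ odd n -> 3 <= k -> injective pos0 ->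
  two_mes_corners (config pos0) ->
  ~ partitive (config pos0) ->
  ~ is_2S2 (config pos0) ->
  gatherable_1crash pos0.
Proof.
move=> ne k3 ip [a [mes /eqP/cards2P [u [w [/eqP uw oc]]]]] np n2.
have [a_lt enc _] := mes.
have an : a < n by lia.
pose oa := Ordinal an.
have occ v : v \in [set u; w] -> mes_corner oa v /\ exists i, pos0 i = v.
  rewrite -oc inE => /andP [cv /eqP fv]; split=> //.
  apply: NNPP => h; apply: fv; apply: config_eq0 => j hj; apply: h; by exists j.
have [cu [iA pA]] := occ u (set21 _ _).
have [cw [iB pB]] := occ w (set22 _ _).
have nz i : config pos0 (pos0 i) != 0.
  by rewrite (config_eq1 (p := pos0) (i := i)) // => j /ip.
have sq i : insq oa (pos0 i) by exact: (enc _ (nz i)).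
have cor i : mes_corner oa (pos0 i) -> i = iA \/ i = iB.
  move=> ci; have : pos0 i \in occ_corners (config pos0) a by rewrite inE ci nz.
  by rewrite oc !inE => /orP [] /eqP; rewrite -?pA -?pB => /ip; [left | right].
have [j jA jB] : exists2 j, j <> iA & j <> iB.
  have : 0 < #|~: [set iA; iB]|.
    by have := cardsC [set iA; iB]; rewrite card_ord cards2; case: (iA != iB); lia.
  rewrite card_gt0 => /set0Pn [j]; rewrite !inE => /norP [/eqP jA /eqP jB].
  by exists j.
(* A third robot stands off the corners, so the even side length [n - oa.*2] is not two. *)
have a_small : oa.*2 + 3 < n.
  have : ~~ mes_corner oa (pos0 j) by apply/negP => /cor [].
  have := sq j; rewrite /insq /mes_corner.
  by case: (pos0 j) => [[x hx] [y hy]] /=; lia.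
have n3 : 3 < n by lia.
have ns := no_swap ne n3 np n2 mes oc uw.
have [c [side [cuA cwB]]] := corner_frame cu cw uw.
apply: (gatherable_transport (graph_aut_fr n c)).
apply: (@cornered_gatherable _ _ oa ne a_small side _ iA iB j) => //.
- by move=> i i' /fr_inj /ip.
- by rewrite pA.
- by rewrite pB.
- by move=> i; rewrite insq_fr.
- by move=> i; rewrite mes_corner_fr; exact: cor.
by rewrite -cuA -cwB; exact: unswappable_fr.
Qed.
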